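(* Let $f:[a,b)\to\mathbb{R}$, $a\le b<\infty$, be a convex function, and let $N\ge 1$ and $n_1\ge 1$ be integers. Let $\mathbf{p}_1=(p_{1,1},\dots,p_{n_1,1})$ satisfy $p_{i,1}\ge 0$ for $i=1,\dots,n_1$ and $\sum_{i=1}^{n_1}p_{i,1}=1$, and let $\mathbf{x}_1=(x_{1,1},\dots,x_{n_1,1})\in[a,b)^{n_1}$. Let the index sets $I_k$, their cardinalities $n_k$, the given weight tuples $\mathbf{q}_k=(q_{i,k})_{i\in I_k}$ (with $q_{i,k}>0$ and $\sum_{i\in I_k}q_{i,k}=1$), the tuples $\mathbf{x}_k=(x_{i,k})_{i\in I_k}$ and the numbers $M_k$, $k=1,\dots,N$, be as in the recursion described in the context, where $j_1$ is a fixed index with $M_1=\max_{1\le i\le n_1}\frac{p_{i,1}}{q_{i,1}}=\frac{p_{j_1,1}}{q_{j_1,1}}$. Then $$J_{n_1}(f,\mathbf{x}_1,\mathbf{p}_1)-\sum_{k=1}^N M_k\,J_{n_k}(f,\mathbf{x}_k,\mathbf{q}_k)\ \le\ 0,$$ $$M_k=\frac{p_{j_1,1}}{\prod_{m=1}^k q_{j_1,m}},\qquad k=1,\dots,N$$ (in particular $j_1\in I_k$ for every $k$, so that this expression is meaningful), and $$n_1\ge n_2=n_k,\qquad k=2,\dots,N.$$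
   Context: Jensen functional: for a function $f$ on an interval, a tuple $\mathbf{x}=(x_i)_{i\in I}$ of points of the interval indexed by a finite set $I$ with $n$ elements and weights $\mathbf{p}=(p_i)_{i\in I}$ with $\sum_{i\in I} p_i=1$, $$J_n(f,\mathbf{x},\mathbf{p})=\sum_{i\in I} p_i f(x_i)-f\Big(\sum_{i\in I} p_i x_i\Big).$$ Recursion (at each step all indices with vanishing new weight $p_{i,k-1}-M_{k-1}q_{i,k-1}=0$ are eliminated, except that one chosen maximizing index is kept and carries the new entry). Put $I_1=\{1,\dots,n_1\}$. The tuples $\mathbf{q}_k=(q_{i,k})_{i\in I_k}$ are arbitrary given positive weight tuples with sum $1$; they are not constructed. For $k=1,\dots,N$ put $$M_k=\max_{i\in I_k}\frac{p_{i,k}}{q_{i,k}}=\frac{p_{j_k,k}}{q_{j_k,k}},$$ where $j_k\in I_k$ is a specific (chosen) index at which the maximum is attained. For $k=2,\dots,N$ define $$I_k=\Big\{i\in I_{k-1}:\ \frac{p_{i,k-1}}{q_{i,k-1}}\ne M_{k-1}\Big\}\cup\{j_{k-1}\},\qquad n_k=|I_k|,$$ $$p_{i,k}=p_{i,k-1}-M_{k-1}q_{i,k-1},\qquad x_{i,k}=x_{i,k-1}\qquad\text{for } i\in I_k,\ i\ne j_{k-1},$$ $$p_{j_{k-1},k}=M_{k-1},\qquad x_{j_{k-1},k}=\sum_{l\in I_{k-1}} q_{l,k-1}x_{l,k-1}.$$ *)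

(* Defs.v *)
From mathcomp Require Import all_boot all_order all_algebra.
From mathcomp Require Import all_classical all_reals all_analysis.

Set Implicit Arguments.
Unset Strict Implicit.
Unset Printing Implicit Defensive.

Import Order.TTheory GRing.Theory Num.Theory.

Local Open Scope ring_scope.

Definition jensen_functional (R : realType) (T : finType) (f : R -> R)
    (I : {set T}) (x p : T -> R) : R :=
  \sum_(i in I) p i * f (x i) - f (\sum_(i in I) p i * x i).

(* Steps are numbered from 1: the values of all families at step 0 are
   irrelevant, and so are the values of p k, q k and x k outside I k.
   The index set {1, ..., n1} is represented by 'I_n1. *)
Record jensen_recursion (R : realType) (n1 N : nat) (I : nat -> {set 'I_n1})
    (p q x : nat -> 'I_n1 -> R) (M : nat -> R) (j : nat -> 'I_n1) : Prop := {
  rec_I1 : I 1%N = [set: 'I_n1];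
  (* M k is the maximum of the ratios, attained at the chosen index j k *)
  rec_j_in : forall k, (1 <= k <= N)%N -> j k \in I k;
  rec_M_attained : forall k, (1 <= k <= N)%N -> M k = p k (j k) / q k (j k);
  rec_M_ub : forall k i, (1 <= k <= N)%N -> i \in I k -> p k i / q k i <= M k;
  rec_I : forall k, (2 <= k <= N)%N ->
    I k = [set i in I k.-1 | p k.-1 i / q k.-1 i != M k.-1]
            :|: [set j k.-1];
  rec_p : forall k i, (2 <= k <= N)%N -> i \in I k -> i != j k.-1 ->
    p k i = p k.-1 i - M k.-1 * q k.-1 i;
  rec_x : forall k i, (2 <= k <= N)%N -> i \in I k -> i != j k.-1 ->
    x k i = x k.-1 i;
  rec_p_j : forall k, (2 <= k <= N)%N -> p k (j k.-1) = M k.-1;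
  rec_x_j : forall k, (2 <= k <= N)%N ->
    x k (j k.-1) = \sum_(l in I k.-1) q k.-1 l * x k.-1 l
}.

(* Main.v *)
Require Import Defs.
From mathcomp Require Import all_boot all_order all_algebra.
From mathcomp Require Import all_classical all_reals all_analysis.
From mathcomp Require Import ring lra.

(** Each step of the recursion subtracts M_k times the Jensen functional with
weights q_k.  Indeed, for every function g,
  sum p_(k+1) g(x_(k+1)) = sum (p_k - M_k q_k) g(x_k) + M_k g(sum q_k x_k),
since the discarded indices and the old entry at j_k carry the weight
p_k - M_k q_k = 0.  For g = 1 and g = id this shows that the total weight 1 and
the barycenter sum p_k x_k do not change; for g = f it then gives
  J(f, x_(k+1), p_(k+1)) = J(f, x_k, p_k) - M_k J(f, x_k, q_k).
The sum in the theorem therefore telescopes to J(f, x_N, p_N) - M_N J(f, x_N, q_N).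

It remains to see that J(f, x, p) <= M J(f, x, q) whenever p <= M q
([jensen_functional_le]).  The weights p may be negative here, but
  M (sum q x) = sum p x + sum (M q - p) x
writes M times the q-barycenter as a combination with nonnegative coefficients
of total mass M, so this is Jensen's inequality for the points x together with
the barycenter sum p x, which has to lie in the domain.  It does, because it is
the barycenter of the initial points with the initial, nonnegative weights.

For the formula for M_k and the cardinalities, note that M_1 > 0 because the
initial weights sum to 1.  After a step with M_k > 0, the weights other than the
one at j_k are the values p_k - M_k q_k of indices that do not attain the
maximum, hence negative, while the weight at j_k is M_k > 0.  So j_k is the only
index with a positive ratio: it is chosen again, M_(k+1) = M_k / q_(k+1)(j_k),
and from the second step on no index has to be discarded. *)

Import Order.TTheory GRing.Theory Num.Theory.

Set Implicit Arguments.
Unset Strict Implicit.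
Unset Printing Implicit Defensive.

Local Open Scope ring_scope.

(** * Jensen's inequality for weights of arbitrary total mass *)

Lemma convex_set_itvco (R : realType) (a b : R) :
  convex_set (`[a, b[%classic : set R^o).
Proof.
move=> u v t; rewrite !inE /= !in_itv /=.
have -> : conv t u v = t%:num * u + (1 - t%:num) * v :> R by [].
have t0 : 0 <= t%:num by [].
have t1 : t%:num <= 1 by [].
move=> /andP[au ub] /andP[av vb].
by have [uv|/ltW vu] := lerP u v; apply/andP; split; nra.
Qed.

(** The barycenter enters through the equation (s + t) c = s u + t v, so that
no quotient has to be formed when masses are added up in the induction of
[weighted_jensen]. *)
Lemma weighted_convex2 (R : realType) (D : set R) (f : R -> R)
    (s t u v c : R) :
  convex_set (D : set R^o) ->
  convex_function (D : set R^o) (f : R^o -> R^o) ->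
  0 <= s -> 0 <= t -> 0 < s + t -> u \in D -> v \in D ->
  (s + t) * c = s * u + t * v ->
  c \in D /\ (s + t) * f c <= s * f u + t * f v.
Proof.
move=> convD convf s0 t0 st0 uD vD cE.
have l0 : 0 <= s / (s + t) by rewrite divr_ge0 // ltW.
have l1 : s / (s + t) <= 1 by rewrite ler_pdivrMr // mul1r lerDl.
pose l := Itv01 l0 l1.
have convE (u' v' : R) : (s + t) * (conv l (u' : R^o) (v' : R^o)) = s * u' + t * v'.
  have -> : conv l (u' : R^o) (v' : R^o)
      = s / (s + t) * u' + (1 - s / (s + t)) * v' :> R by [].
  by field; rewrite gt_eqF.
have -> : c = conv l (u : R^o) (v : R^o).
  by apply: (mulfI (lt0r_neq0 st0)); rewrite cE convE.
split; first exact: convD.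
by rewrite -convE ler_pM2l //; exact: convf.
Qed.

(** The triples (mass, moment, value) that admit a barycenter c0 in the domain
satisfying Jensen's inequality are closed under addition, by [weighted_convex2];
each single point gives such a triple, and hence so does the whole family. *)
Lemma weighted_jensen (R : realType) (T : finType) (D : set R) (f : R -> R)
    (A : {set T}) (w y : T -> R) (c : R) :
  convex_set (D : set R^o) ->
  convex_function (D : set R^o) (f : R^o -> R^o) ->
  (forall i, i \in A -> 0 <= w i) -> (forall i, i \in A -> y i \in D) ->
  0 < \sum_(i in A) w i ->
  (\sum_(i in A) w i) * c = \sum_(i in A) w i * y i ->
  c \in D /\ (\sum_(i in A) w i) * f c <= \sum_(i in A) w i * f (y i).
Proof.
move=> convD convf w_ge0 yD W_gt0 bary.
have [A0|[i0 /yD i0D]] := set_0Vmem A.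
  by move: W_gt0; rewrite A0 big_set0 ltxx.
(* A triple of mass 0 must also have some c0 in the domain; any point of the
   family serves. *)
pose K (W S F : R) :=
  0 <= W /\ exists c0, [/\ c0 \in D, W * c0 = S & W * f c0 <= F].
have [_ [c0 [c0D c0E le_f]]] :
    K (\sum_(i in A) w i) (\sum_(i in A) w i * y i)
      (\sum_(i in A) w i * f (y i)).
  apply: (big_ind3 K).
  - by split=> //; exists (y i0); rewrite !mul0r.
  - move=> W1 S1 F1 W2 S2 F2.
    move=> [W1_ge0 [c1 [c1D <- le1]]] [W2_ge0 [c2 [c2D <- le2]]].
    split; first exact: addr_ge0.
    (* Without mass the barycenter is not determined by the moment. *)
    have [W0|W_neq0] := eqVneq (W1 + W2) 0.
      have {}W1_0 : W1 = 0 by lra.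
      have {}W2_0 : W2 = 0 by lra.
      exists c1; rewrite W1_0 W2_0 in le1 le2 *.
      by split=> //; lra.
    have W_pos : 0 < W1 + W2 by rewrite lt0r W_neq0 addr_ge0.
    have cE : (W1 + W2) * ((W1 * c1 + W2 * c2) / (W1 + W2))
        = W1 * c1 + W2 * c2 by rewrite mulrC divfK.
    have [cD le_c] := weighted_convex2 convD convf W1_ge0 W2_ge0 W_pos
                        c1D c2D cE.
    exists ((W1 * c1 + W2 * c2) / (W1 + W2)); split=> //.
    by apply: le_trans le_c _; exact: lerD.
  - move=> i iA; split; first exact: w_ge0.
    by exists (y i); split=> //; exact: yD.
have -> : c = c0 by apply: (mulfI (lt0r_neq0 W_gt0)); rewrite bary -c0E.
by split.
Qed.

(** Only the weights M q - p and the weight 1 at the p-barycenter need to be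
nonnegative for Jensen's inequality: together they have mass M and the same
barycenter as q.  The p-barycenter must be assumed to lie in the domain since
the p i may be negative. *)
Lemma jensen_functional_le (R : realType) (T : finType) (D : set R)
    (f : R -> R) (A : {set T}) (x p q : T -> R) (M : R) :
  convex_set (D : set R^o) ->
  convex_function (D : set R^o) (f : R^o -> R^o) ->
  \sum_(i in A) p i = 1 -> \sum_(i in A) q i = 1 ->
  (forall i, i \in A -> p i <= M * q i) ->
  (forall i, i \in A -> x i \in D) -> \sum_(i in A) p i * x i \in D ->
  jensen_functional f A x p <= M * jensen_functional f A x q.
Proof.
move=> convD convf p1 q1 pMq xD baryD.
(* [None] stands for the additional point, the p-barycenter. *)
pose w (o : option T) := if o is Some i then M * q i - p i else 1.
pose y (o : option T) := if o is Some i then x i else \sum_(i in A) p i * x i.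
pose B := None |: [set Some i | i in A].
have sumB (F : option T -> R) :
    \sum_(o in B) F o = F None + \sum_(i in A) F (Some i).
  rewrite big_setU1 /=; last by apply/imsetP => -[].
  by rewrite big_imset //= => i i' _ _ [].
have sumD (g : R -> R) : \sum_(i in A) (M * q i - p i) * g (x i)
    = M * (\sum_(i in A) q i * g (x i)) - \sum_(i in A) p i * g (x i).
  by rewrite mulr_sumr -sumrB; apply: eq_bigr => i _; rewrite mulrBl mulrA.
have W : \sum_(o in B) w o = M.
  by rewrite sumB /= sumrB -mulr_sumr p1 q1; ring.
have BP o : o \in B -> o = None \/ exists2 i, i \in A & o = Some i.
  by rewrite !inE => /orP[/eqP->|/imsetP[i iA ->]]; [left|right; exists i].
have w_ge0 o : o \in B -> 0 <= w o.
  by case/BP=> [->|[i iA ->]] //=; rewrite subr_ge0 pMq.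
have M_gt0 : 0 < M.
  rewrite -W sumB /= (lt_le_trans ltr01) // lerDl.
  by apply: sumr_ge0 => i iA; rewrite subr_ge0 pMq.
have [] := @weighted_jensen R _ D f B w y (\sum_(i in A) q i * x i)
             convD convf w_ge0.
- by move=> o /BP[->|[i iA ->]] //=; exact: xD.
- by rewrite W.
- by rewrite W sumB /= (sumD id); ring.
move=> _; rewrite W sumB /= sumD /jensen_functional; lra.
Qed.

(** * One step of the recursion *)

(** Both the indices that are removed and the index [j k], whose entry is
overwritten, carry the weight [p k i - M k * q k i = 0], so they can be put back
into the sum at no cost.  Used with [g] equal to 1, the identity and [f]. *)
Lemma sum_after_merge (R : realType) (n1 N : nat) (I : nat -> {set 'I_n1})
    (p q x : nat -> 'I_n1 -> R) (M : nat -> R) (j : nat -> 'I_n1)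
    (k : nat) (g : R -> R) :
  jensen_recursion N I p q x M j ->
  (forall i, i \in I k -> 0 < q k i) -> (1 <= k < N)%N ->
  \sum_(i in I k.+1) p k.+1 i * g (x k.+1 i) =
    \sum_(i in I k) p k i * g (x k i)
    - M k * (\sum_(i in I k) q k i * g (x k i))
    + M k * g (\sum_(i in I k) q k i * x k i).
Proof.
move=> hrec q_gt0 /andP[k1 kN].
have k2 : (2 <= k.+1 <= N)%N by rewrite ltnS k1.
have kk : (1 <= k <= N)%N by rewrite k1 ltnW.
have jI := rec_j_in hrec kk.
have IE := rec_I hrec k2.
have jI' : j k \in I k.+1 by rewrite IE !inE eqxx orbT.
have I'I i : i \in I k.+1 -> i \in I k.
  by rewrite IE !inE => /orP[/andP[]|/eqP->].
have pM i : i \in I k -> p k i / q k i = M k -> p k i - M k * q k i = 0.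
  by move=> iI <-; rewrite divfK ?subrr // gt_eqF ?q_gt0.
rewrite mulr_sumr -sumrB (bigD1 (j k)) //= (rec_p_j hrec k2) (rec_x_j hrec k2).
rewrite [LHS]addrC; congr (_ + _).
rewrite [RHS](bigD1 (j k)) //= mulrA -mulrBl pM -?(rec_M_attained hrec) //.
rewrite mul0r add0r.
rewrite [RHS](bigID [pred i | p k i / q k i == M k]) /= [X in _ = X + _]big1 ?add0r.
  apply: eq_big => [i|i /andP[iI' ij]].
    by rewrite IE !inE; case: (i == j k); rewrite ?andbF ?orbF ?andbT.
  by rewrite (rec_p hrec k2) // (rec_x hrec k2) // mulrBl mulrA.
move=> i /andP[/andP[iI _] /eqP iM].
by rewrite mulrA -mulrBl pM // mul0r.
Qed.

(** The barycenter is unchanged by the step, so the terms f(sum p x) cancel. *)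
Lemma jensen_functional_after_merge (R : realType) (f : R -> R) (n1 N : nat)
    (I : nat -> {set 'I_n1}) (p q x : nat -> 'I_n1 -> R) (M : nat -> R)
    (j : nat -> 'I_n1) (k : nat) :
  jensen_recursion N I p q x M j ->
  (forall i, i \in I k -> 0 < q k i) -> (1 <= k < N)%N ->
  jensen_functional f (I k.+1) (x k.+1) (p k.+1) =
    jensen_functional f (I k) (x k) (p k)
    - M k * jensen_functional f (I k) (x k) (q k).
Proof.
move=> hrec q_gt0 kN; rewrite /jensen_functional.
rewrite (sum_after_merge f hrec q_gt0 kN).
have -> : \sum_(i in I k.+1) p k.+1 i * x k.+1 i = \sum_(i in I k) p k i * x k i.
  by rewrite (sum_after_merge id hrec q_gt0 kN) /=; ring.
ring.
Qed.

(** Although the later weights have negative entries, their barycenter stays in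
the domain because it is still that of the initial nonnegative weights. *)
Lemma recursion_invariant (R : realType) (D : set R) (n1 N : nat)
    (I : nat -> {set 'I_n1}) (p q x : nat -> 'I_n1 -> R) (M : nat -> R)
    (j : nat -> 'I_n1) (k : nat) :
  jensen_recursion N I p q x M j ->
  convex_set (D : set R^o) ->
  (forall k i, (1 <= k <= N)%N -> i \in I k -> 0 < q k i) ->
  (forall k, (1 <= k <= N)%N -> \sum_(i in I k) q k i = 1) ->
  \sum_(i in I 1%N) p 1%N i = 1 ->
  (forall i, p 1%N i >= 0) ->
  (forall i, x 1%N i \in D) -> (1 <= k <= N)%N ->
  [/\ \sum_(i in I k) p k i = 1,
      \sum_(i in I k) p k i * x k i \in D
    & forall i, i \in I k -> x k i \in D].
Proof.
move=> hrec convD q_gt0 q_sum p1 p_ge0 xD.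
have bary (A : {set 'I_n1}) (w y : 'I_n1 -> R) : \sum_(i in A) w i = 1 ->
    (forall i, i \in A -> 0 <= w i) -> (forall i, i \in A -> y i \in D) ->
    \sum_(i in A) w i * y i \in D.
  move=> w1 w0 yD.
  (* Membership of the barycenter is the first half of [weighted_jensen], which
     is applied to the zero function. *)
  have convf0 : convex_function (D : set R^o) ((fun=> 0) : R^o -> R^o).
    by move=> t u v _ _; rewrite convmm.
  have w_gt0 : 0 < \sum_(i in A) w i by rewrite w1.
  have [|cD _] // := weighted_jensen (c := \sum_(i in A) w i * y i)
    convD convf0 w0 yD w_gt0.
  by rewrite w1 mul1r.
elim: k => // -[_ _|k IHk kN]; first by split=> //; exact: bary.
have k1 : (1 <= k.+1 <= N)%N by exact: ltnW kN.
have qk i (iI : i \in I k.+1) := q_gt0 _ _ k1 iI.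
have [pk baryk xkD] := IHk k1.
have sumE g := sum_after_merge g hrec qk kN.
split.
- have := sumE (fun=> 1).
  under eq_bigr do rewrite mulr1.
  under [X in _ = X - _ + _]eq_bigr do rewrite mulr1.
  under [X in _ = _ - _ * X + _]eq_bigr do rewrite mulr1.
  by move=> ->; rewrite pk q_sum //; ring.
- by have -> := sumE id; rewrite /= subrK.
- move=> i iI; have [->|ij] := eqVneq i (j k.+1).
    rewrite (rec_x_j hrec) //.
    by apply: bary => //; [exact: q_sum|move=> l /qk/ltW].
  rewrite (rec_x hrec) //; apply: xkD.
  by move: iI; rewrite (rec_I hrec) // !inE (negbTE ij) orbF => /andP[].
Qed.

(** * Stability of the chosen index and of the index set *)

(** A surviving index other than [j k] has a ratio strictly below the maximum. *)
Lemma weights_neg_after_merge (R : realType) (n1 N : nat)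
    (I : nat -> {set 'I_n1}) (p q x : nat -> 'I_n1 -> R) (M : nat -> R)
    (j : nat -> 'I_n1) (k : nat) (i : 'I_n1) :
  jensen_recursion N I p q x M j ->
  (forall i, i \in I k -> 0 < q k i) -> (1 <= k < N)%N ->
  i \in I k.+1 -> i != j k -> p k.+1 i < 0.
Proof.
move=> hrec q_gt0 kN iI' ij; have /andP[k1 ltkN] := kN.
have kk : (1 <= k <= N)%N by rewrite k1 ltnW.
rewrite (rec_p hrec) //.
move: iI'; rewrite (rec_I hrec) // !inE (negbTE ij) orbF => /andP[iI ne].
rewrite subr_lt0 -ltr_pdivrMr ?q_gt0 //.
by rewrite lt_neqAle ne (rec_M_ub hrec).
Qed.

(** The new weight at [j k] is [M k > 0] and all the others are negative, so the
next maximum is attained at [j k] and nowhere else. *)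
Lemma chosen_index_stable (R : realType) (n1 N : nat)
    (I : nat -> {set 'I_n1}) (p q x : nat -> 'I_n1 -> R) (M : nat -> R)
    (j : nat -> 'I_n1) (k : nat) :
  jensen_recursion N I p q x M j ->
  (forall k i, (1 <= k <= N)%N -> i \in I k -> 0 < q k i) ->
  (1 <= k < N)%N -> 0 < M k ->
  [/\ j k.+1 = j k, M k.+1 = M k / q k.+1 (j k) & 0 < M k.+1].
Proof.
move=> hrec q_gt0 kN Mk; have /andP[k1 ltkN] := kN.
have kk : (1 <= k <= N)%N by rewrite k1 ltnW.
have k1N : (1 <= k.+1 <= N)%N by [].
have jI' : j k \in I k.+1 by rewrite (rec_I hrec) // !inE eqxx orbT.
have M'0 : 0 < M k.+1.
  apply: lt_le_trans (rec_M_ub hrec k1N jI').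
  by rewrite (rec_p_j hrec) // divr_gt0 // q_gt0.
have jE : j k.+1 = j k.
  have j'I := rec_j_in hrec k1N.
  apply/eqP/negPn/negP => /(weights_neg_after_merge hrec (q_gt0 k ^~ kk) kN j'I).
  move: M'0; rewrite (rec_M_attained hrec k1N) pmulr_lgt0 ?invr_gt0 ?q_gt0 //.
  by move=> /ltW; rewrite leNgt => /negP.
by split=> //; rewrite (rec_M_attained hrec k1N) jE (rec_p_j hrec).
Qed.

(** After a first step, every index but the chosen one has a negative ratio, which
differs from the positive maximum; nothing is eliminated any more. *)
Lemma index_set_stable (R : realType) (n1 N : nat)
    (I : nat -> {set 'I_n1}) (p q x : nat -> 'I_n1 -> R) (M : nat -> R)
    (j : nat -> 'I_n1) (k : nat) :
  jensen_recursion N I p q x M j ->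
  (forall k i, (1 <= k <= N)%N -> i \in I k -> 0 < q k i) ->
  (1 <= k)%N -> (k.+2 <= N)%N -> 0 < M k ->
  I k.+2 = I k.+1.
Proof.
move=> hrec q_gt0 k1 kN Mk.
have kk : (1 <= k < N)%N by rewrite k1 ltnW.
have kk' : (1 <= k <= N)%N by rewrite k1 (ltnW (ltnW kN)).
have [jE _ M'0] := chosen_index_stable hrec q_gt0 kk Mk.
have k2 : (2 <= k.+2 <= N)%N by [].
have k1N : (1 <= k.+1 <= N)%N by exact: ltnW kN.
rewrite (rec_I hrec k2) /=; apply/setP => i; rewrite !inE.
have [->|ij] := eqVneq i (j k.+1); first by rewrite orbT (rec_j_in hrec).
rewrite orbF andb_idr // => iI; rewrite jE in ij.
have pneg := weights_neg_after_merge hrec (q_gt0 k ^~ kk') kk iI ij.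
by rewrite lt_eqF // (lt_trans _ M'0) // pmulr_llt0 // invr_gt0 q_gt0.
Qed.

Unset Implicit Arguments.

(** * Telescoping *)

Theorem theorem9 (R : realType) (a b : R) (f : R -> R) (N n1 : nat)
    (I : nat -> {set 'I_n1}) (p q x : nat -> 'I_n1 -> R)
    (M : nat -> R) (j : nat -> 'I_n1)
    (hab : a <= b)
    (hf : convex_function (`[a, b[%classic : set R^o) (f : R^o -> R^o))
    (hN : (1 <= N)%N) (hn1 : (1 <= n1)%N)
    (hp_ge0 : forall i : 'I_n1, 0 <= p 1%N i)
    (hp_sum : \sum_(i < n1) p 1%N i = 1)
    (hx : forall i : 'I_n1, x 1%N i \in `[a, b[)
    (hq_gt0 : forall (k : nat) (i : 'I_n1),
      (1 <= k <= N)%N -> i \in I k -> 0 < q k i)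
    (hq_sum : forall k : nat, (1 <= k <= N)%N -> \sum_(i in I k) q k i = 1)
    (hrec : jensen_recursion N I p q x M j) :
  [/\ jensen_functional f (I 1%N) (x 1%N) (p 1%N)
        - \sum_(1 <= k < N.+1) M k * jensen_functional f (I k) (x k) (q k) <= 0,
      (forall k : nat, (1 <= k <= N)%N ->
         j 1%N \in I k /\
         M k = p 1%N (j 1%N) / \prod_(1 <= m < k.+1) q m (j 1%N))
    & (forall k : nat, (2 <= k <= N)%N ->
         (#|I 2%N| <= n1)%N /\ #|I k| = #|I 2%N|)].
Proof.
have I1E := rec_I1 hrec.
have N1 : (1 <= 1 <= N)%N by rewrite hN.
have p1 : \sum_(i in I 1%N) p 1%N i = 1.
  by rewrite -hp_sum; apply: eq_bigl => i; rewrite I1E inE.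
have xD i : x 1%N i \in (`[a, b[%classic : set R) by rewrite inE /= hx.
(* Summing p <= M q over all indices gives 1 <= M, for weights of sum 1. *)
have M1_gt0 : 0 < M 1%N.
  have M1_ge i : p 1%N i <= M 1%N * q 1%N i.
    have iI : i \in I 1%N by rewrite I1E inE.
    by rewrite -ler_pdivrMr ?hq_gt0 // (rec_M_ub hrec).
  suff : 1 <= M 1%N by apply: lt_le_trans.
  by rewrite -p1 -[leRHS]mulr1 -(hq_sum _ N1) mulr_sumr; apply: ler_sum.
have stab k : (1 <= k <= N)%N -> [/\ j k = j 1%N, 0 < M k &
    M k = p 1%N (j 1%N) / \prod_(1 <= m < k.+1) q m (j 1%N)].
  elim: k => // -[_ _|k IHk kN].
    by split=> //; rewrite big_nat1 (rec_M_attained hrec).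
  have [jk Mk ME] := IHk (ltnW kN).
  have [jE M'E M'0] := chosen_index_stable (k := k.+1) hrec hq_gt0 kN Mk.
  split; [by rewrite jE | by [] |].
  by rewrite M'E ME jk [in RHS]big_nat_recr //= invfM mulrA.
split.
- have sumE k : (1 <= k <= N)%N ->
      jensen_functional f (I 1%N) (x 1%N) (p 1%N)
      - \sum_(1 <= m < k) M m * jensen_functional f (I m) (x m) (q m)
      = jensen_functional f (I k) (x k) (p k).
    elim: k => // -[_ _|k IHk kN]; first by rewrite big_geq // subr0.
    have k1 : (1 <= k.+1 <= N)%N by exact: ltnW kN.
    rewrite big_nat_recr //= opprD addrA IHk //.
    by rewrite (jensen_functional_after_merge (k := k.+1) f hrec _ kN) // => i; exact: hq_gt0.
  have NN : (1 <= N <= N)%N by rewrite hN leqnn.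
  rewrite big_nat_recr //= opprD addrA sumE // subr_le0.
  have convD := @convex_set_itvco R a b.
  have [pN baryD xND] := recursion_invariant hrec convD hq_gt0 hq_sum p1 hp_ge0 xD NN.
  apply: (jensen_functional_le convD hf pN (hq_sum _ NN) _ xND baryD) => i iI.
  by rewrite -ler_pdivrMr ?hq_gt0 // (rec_M_ub hrec).
- move=> k kN; have [jE _ ME] := stab k kN.
  by split=> //; rewrite -jE (rec_j_in hrec).
- move=> k kN; split; first by rewrite -[leqRHS]card_ord max_card.
  elim: k kN => [|[|[|k]] IHk kN] //.
  have [_ Mk _] := stab k.+1 (ltnW (ltnW kN)).
  rewrite (index_set_stable (k := k.+1) hrec hq_gt0 _ kN Mk) //.
  by apply: IHk; exact: ltnW kN.
Qed.
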